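(* Assume the setting described in the context. The admissible transvectants $(\alpha^{\mathbf k},\mathbf b_j)^{(s)}$, for $\mathbf k\in A$, $j=1,\dots,q$, and integers $0\le s\le\widehat\alpha\mathbf k$, $0\le s\le n_j-1$, form a formal vector space basis of $\mathcal E=\ker L_{N^*}$: they lie in $\mathcal E$, are linearly independent, and every element of $\mathcal E$ is a countable linear combination of them.
   Context: Let $N$ be a real nilpotent $n\times n$ matrix in upper Jordan form with Jordan blocks of sizes $n_1,\dots,n_q$ (block $N_k$ has ones on the superdiagonal, zeros elsewhere). Let $M$ and $H$ be block diagonal with corresponding blocks $M_k$ ($k\times k$, zero except subdiagonal entries $(M_k)_{i+1,i}=i(k-i)$, $i=1,\dots,k-1$) and $H_k=\mathrm{diag}(k-1,k-3,\dots,-(k-1))$; $(N,M,H)$ is an $\mathfrak{sl}_2$ triad. $^*$ is transpose. For a matrix $A$ and $f\in\mathbb R[[\mathbf x]]$, $\mathcal D_Af(\mathbf x)=f'(\mathbf x)A\mathbf x$; set $\mathcal X=\mathcal D_{N^*}$, $\mathcal Y=\mathcal D_{M^*}$, $\mathcal Z=\mathcal D_H$, $\mathcal J=\ker\mathcal X\subset\mathbb R[[\mathbf x]]$. A weight invariant is $f\in\mathcal J$ with $\mathcal Zf=\widehat ff$. For formal vector fields $\mathbf v$ on $\mathbb R^n$, $L_A\mathbf v=\mathbf v'(\mathbf x)A\mathbf x-A\mathbf v(\mathbf x)$, and $\mathcal E=\ker L_{N^*}$. Let $\alpha=(\alpha_1,\dots,\alpha_p)$ be a Hilbert basis of $\mathcal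 J$ (homogeneous weight invariants, weights $\widehat\alpha_i$, whose monomials $\alpha^{\mathbf k}$ span $\mathcal J$ by countable linear combinations; $\widehat\alpha\mathbf k=\sum\widehat\alpha_ik_i$) and $A\subset\mathbb N^p$ a standard preferred set (the $\alpha^{\mathbf k}$, $\mathbf k\in A$, pairwise distinct, linearly independent, spanning $\mathcal J$ by countable combinations; $A$ closed under componentwise-smaller vectors). Let $\mathbf b_j=\mathbf e_{r_j}$ be the standard basis vector of $\mathbb R^n$ whose index $r_j$ is the bottom row of the $j$-th Jordan block; it satisfies $N^*\mathbf b_j=0$ and $-H\mathbf b_j=(n_j-1)\mathbf b_j$; its weight is $\widehat{\mathbf b}_j=n_j-1$. For a weight invariant $f$, $\mathbf w=\mathbf b_j$, and $0\le s\le\min(\widehat f,\widehat{\mathbf w})$, the transvectant is the vector field $(f,\mathbf w)^{(s)}=\sum_{i=0}^s(-1)^i\binom si\frac{(\widehat f-i)!}{(\widehat f-s)!}\frac{(\widehat{\mathbf w}-s+i)!}{(\widehat{\mathbf w}-s)!}(\mathcal Y^if)\,\bigl((-M^* )^{s-i}\mathbf w\bigr)$. *)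

(* Defs.v *)
From HB Require Import structures.
From mathcomp Require Import all_boot all_order all_algebra.
From mathcomp Require Import reals.
Set Implicit Arguments. Unset Strict Implicit. Unset Printing Implicit Defensive.
Import Order.TTheory GRing.Theory Num.Theory.
Local Open Scope ring_scope.

Section FormalSeries.
Variables (R : realType) (n : nat).

Definition mon := {ffun 'I_n -> nat}.
Definition series := mon -> R.
Definition vfield := 'I_n -> series.

Definition mdeg (m : mon) : nat := (\sum_i m i)%N.

Definition sone : series := fun m => (m == [ffun => 0%N])%:R.

Definition smul (f g : series) : series := fun m =>
  \sum_(a : {ffun 'I_n -> 'I_(mdeg m).+1} | [forall i, (a i <= m i)%N])
     f [ffun i => nat_of_ord (a i)] * g [ffun i => (m i - a i)%N].

Definition spow (f : series) (k : nat) : series := iter k (smul f) sone.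

Definition mulX (j : 'I_n) (f : series) : series := fun m =>
  if (0 < m j)%N then f [ffun l => (m l - (l == j))%N] else 0.

Definition dX (i : 'I_n) (f : series) : series := fun m =>
  (m i).+1%:R * f [ffun l => (m l + (l == i))%N].

(* D_A f (x) = f'(x) A x = sum_{i,j} (d_i f) A_{ij} x_j *)
Definition Dop (A : 'M[R]_n) (f : series) : series := fun m =>
  \sum_i \sum_j A i j * mulX j (dX i f) m.

Definition Lop (A : 'M[R]_n) (v : vfield) : vfield := fun k m =>
  Dop A (v k) m - \sum_l A k l * v l m.

Definition homogeneous (f : series) : Prop :=
  exists d : nat, forall m, f m != 0 -> mdeg m = d.

Definition inJ (N : 'M[R]_n) (f : series) : Prop := forall m, Dop N^T f m = 0.

Definition weight_inv (N H : 'M[R]_n) (f : series) (w : nat) : Prop :=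
  inJ N f /\ forall m, Dop H f m = w%:R * f m.

(* f is a countable (formal) linear combination of the v i, i with P i:
   there are coefficients c such that, coefficientwise, only finitely many
   terms contribute and the (finite) coefficient sums give f. *)
Definition fcomb (X : Type) (I : eqType) (P : I -> Prop) (v : I -> X -> R)
    (f : X -> R) : Prop :=
  exists c : I -> R, forall x : X, exists s : seq I,
    [/\ uniq s, (forall i, i \in s -> P i),
        (forall i, P i -> c i * v i x != 0 -> i \in s) &
        f x = \sum_(i <- s) c i * v i x].

Definition lin_indep (X : Type) (I : eqType) (P : I -> Prop) (v : I -> X -> R)
    : Prop :=
  forall (s : seq I) (c : I -> R), uniq s -> (forall i, i \in s -> P i) ->
    (forall x, \sum_(i <- s) c i * v i x = 0) ->
    forall i, i \in s -> c i = 0.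

Definition amono (p : nat) (alpha : 'I_p -> series) (k : {ffun 'I_p -> nat})
    : series :=
  foldr (fun i acc => smul (spow (alpha i) (k i)) acc) sone (enum 'I_p).

Definition wdot (p : nat) (ahat : 'I_p -> nat) (k : {ffun 'I_p -> nat}) : nat :=
  (\sum_i ahat i * k i)%N.

Definition hilbert_basis (N H : 'M[R]_n) (p : nat) (alpha : 'I_p -> series)
    (ahat : 'I_p -> nat) : Prop :=
  (forall i, weight_inv N H (alpha i) (ahat i) /\ homogeneous (alpha i)) /\
  (forall f, inJ N f -> fcomb (fun _ => True) (amono alpha) f).

Definition std_pref_set (N : 'M[R]_n) (p : nat) (alpha : 'I_p -> series)
    (A : {ffun 'I_p -> nat} -> Prop) : Prop :=
  [/\ (forall k1 k2, A k1 -> A k2 -> amono alpha k1 = amono alpha k2 -> k1 = k2),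
      lin_indep A (amono alpha),
      (forall f, inJ N f -> fcomb A (amono alpha) f) &
      (forall k k' : {ffun 'I_p -> nat}, A k -> (forall i, (k' i <= k i)%N) -> A k')].

(* transvectant (f, w)^(s) with weights fw = f-hat, ww = w-hat,
   Y = D_{M^*} *)
Definition transvectant (M : 'M[R]_n) (f : series) (fw : nat)
    (w : 'cV[R]_n) (ww s : nat) : vfield := fun k m =>
  \sum_(i < s.+1)
    ((-1) ^+ i * 'C(s, i)%:R
       * ((fw - i)`!%:R / (fw - s)`!%:R)
       * ((ww - s + i)`!%:R / (ww - s)`!%:R))
    * iter i (Dop M^T) f m
    * (iter (s - i) (fun u => (- M^T) *m u) w) k 0.

End FormalSeries.

Section Triad.
Variables (R : realType) (ns : seq nat).
(* ns = (n_1,...,n_q), block sizes; n = sumn ns; 0-based indices *)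

(* index of the Jordan block containing position i *)
Definition blk (i : nat) : nat :=
  count (fun b => sumn (take b.+1 ns) <= i)%N (iota 0 (size ns)).
Definition off (i : nat) : nat := (i - sumn (take (blk i) ns))%N.
Definition bsz (i : nat) : nat := nth 0%N ns (blk i).

Definition Nmat : 'M[R]_(sumn ns) :=
  \matrix_(i, j) ((blk i == blk j) && (nat_of_ord j == (nat_of_ord i).+1))%:R.

Definition Mmat : 'M[R]_(sumn ns) :=
  \matrix_(i, j)
    (if (blk i == blk j) && (nat_of_ord i == (nat_of_ord j).+1)
     then ((off j).+1 * (bsz j - (off j).+1))%:R else 0).

Definition Hmat : 'M[R]_(sumn ns) :=
  \matrix_(i, j)
    (if i == j then (bsz i).-1%:R - 2 * (off i)%:R else 0).

(* b_j = e_{r_j}, r_j the bottom row of block j (j 0-based) *)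
Definition bvec (j : nat) : 'cV[R]_(sumn ns) :=
  \col_i (nat_of_ord i == (sumn (take j.+1 ns)).-1)%:R.

End Triad.

(* Main.v *)
Require Import Defs.
From HB Require Import structures.
From mathcomp Require Import all_boot all_order all_algebra.
From mathcomp Require Import ring zify.
From mathcomp Require Import boolp functions reals.
Set Implicit Arguments. Unset Strict Implicit. Unset Printing Implicit Defensive.
Import Order.TTheory GRing.Theory Num.Theory.
Local Open Scope ring_scope.

(* Let X, Y, Z be the derivations of N^*, M^*, H. A field v lies in ker L_{N^*} iff on each
   Jordan block X maps every component to the one above it and kills the top one; so v amounts
   to its bottom components g_j, subject only to X^{n_j} g_j = 0. The bottom component of
   (alpha^k, b_j)^(s) in the j-th block is a nonzero multiple of Y^s alpha^k, and it vanishes in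
   the other blocks, so it suffices that the Y^s alpha^k with s < K and s at most the weight of
   alpha^k form a formal basis of ker X^K. Independence: apply X^s for the largest s that occurs.
   Spanning, by induction on K: if X^{K+1} g = 0, expand X^K g in the alpha^k and subtract the
   corresponding multiples of Y^K alpha^k. This needs that only the alpha^k of weight at least K
   occur in X^K g. For a suitable weighted Fischer inner product Y is adjoint to X, and
   weight vectors of distinct weights are orthogonal; the part of X^K g of weight less than K is
   killed by Y^K, hence orthogonal to X^K g and therefore to itself. *)

(** * Formal power series: module structure, products, and the derivations [Dop A] *)

HB.instance Definition _ (R : realType) (n : nat) :=
  GRing.Lmodule.copy (series R n) (mon n -> R^o).

Section Series.
Variables (R : realType) (n : nat).
Implicit Types (f g h : series R n) (m a b : mon n) (A B : 'M[R]_n).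

Lemma seriesD f g m : (f + g) m = f m + g m. Proof. by []. Qed.
Lemma seriesZ (c : R) f m : (c *: f) m = c * f m. Proof. by []. Qed.
Lemma series_sum I (s : seq I) (P : pred I) (F : I -> series R n) m :
  (\sum_(i <- s | P i) F i) m = \sum_(i <- s | P i) F i m.
Proof. by elim/big_rec2: _ => // i x y _ <-. Qed.

Definition up (i : 'I_n) m : mon n := [ffun l => (m l + (l == i))%N].
Definition dn (i : 'I_n) m : mon n := [ffun l => (m l - (l == i))%N].
Definition subm m a : mon n := [ffun i => (m i - a i)%N].

Lemma mdeg_up i m : mdeg (up i m) = (mdeg m).+1.
Proof.
rewrite /mdeg (eq_bigr (fun l => m l + (l == i))%N) => [|l _]; last by rewrite ffunE.
by rewrite big_split /= [X in (_ + X)%N](bigD1 i) //= eqxx [X in (_ + (_ + X))%N]big1 ?addn0 ?addn1 // => l /negbTE ->.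
Qed.

Lemma upK i : cancel (up i) (dn i).
Proof. by move=> m; apply/ffunP => l; rewrite !ffunE addnK. Qed.

Lemma dnK i m : (0 < m i)%N -> up i (dn i m) = m.
Proof. by move=> mi; apply/ffunP=> l; rewrite !ffunE; case: eqP => [->|_]; rewrite ?subnK ?subn0 ?addn0. Qed.

Lemma mdeg_dn i m : (0 < m i)%N -> (mdeg (dn i m)).+1 = mdeg m.
Proof. by move=> mi; rewrite -(mdeg_up i) dnK. Qed.

Lemma leq_mdeg m i : (m i <= mdeg m)%N.
Proof. by rewrite /mdeg (bigD1 i) //= leq_addr. Qed.

(** The type of monomials is infinite, so sums over divisors of a monomial or over a fixed degree
    run along duplicate-free lists filtered from this one. *)
Definition box (K : nat) : seq (mon n) :=
  [seq ([ffun i => nat_of_ord (e i)] : mon n) | e : {ffun 'I_n -> 'I_K}].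

Lemma box_uniq K : uniq (box K).
Proof.
rewrite map_inj_uniq ?enum_uniq // => a b /ffunP ab.
by apply/ffunP=> i; apply/val_inj; have := ab i; rewrite !ffunE.
Qed.

Lemma mem_box K m : (m \in box K) = [forall i, m i < K]%N.
Proof.
apply/mapP/forallP => [[a _ -> i]|mK]; first by rewrite ffunE.
exists [ffun i => Ordinal (mK i)]; first by rewrite mem_enum.
by apply/ffunP=> i; rewrite !ffunE.
Qed.

Definition divs m : seq (mon n) :=
  [seq a : mon n <- box (mdeg m).+1 | [forall i, a i <= m i]%N].
Definition mons (d : nat) : seq (mon n) := [seq m <- box d.+1 | mdeg m == d].

Lemma divs_uniq m : uniq (divs m). Proof. by rewrite filter_uniq ?box_uniq. Qed.
Lemma mons_uniq d : uniq (mons d). Proof. by rewrite filter_uniq ?box_uniq. Qed.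

Lemma mem_divs m a : (a \in divs m) = [forall i, a i <= m i]%N.
Proof.
rewrite mem_filter mem_box andb_idr // => /forallP am; apply/forallP=> i.
by rewrite ltnS (leq_trans (am i)) ?leq_mdeg.
Qed.

Lemma mem_mons d m : (m \in mons d) = (mdeg m == d).
Proof.
rewrite mem_filter mem_box andb_idr // => /eqP <-; apply/forallP=> i.
by rewrite ltnS leq_mdeg.
Qed.

(** The defining sum ranges over a type that depends on [m]. A list of monomials can be compared and
    reindexed across different [m]. *)
Lemma smulE f g m : smul f g m = \sum_(a <- divs m) f a * g (subm m a).
Proof.
rewrite /smul /divs big_filter big_map big_enum_cond /=.
apply: eq_big => [a|a _].
  by apply/forallP/forallP => H i; have := H i; rewrite ?ffunE.
by congr (_ * g _); apply/ffunP=> i; rewrite !ffunE.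
Qed.

(** Reindexing by the involution [subm m] on the divisors of [m]. *)
Lemma smulC f g : smul f g = smul g f.
Proof.
apply/funext=> m; rewrite !smulE.
have inv a : a \in divs m -> subm m (subm m a) = a.
  by rewrite mem_divs => /forallP am; apply/ffunP=> i; rewrite !ffunE subKn.
rewrite (perm_big [seq subm m a | a <- divs m]).
  by rewrite big_map big_seq [RHS]big_seq; apply: eq_bigr => a /inv ->; rewrite mulrC.
apply: uniq_perm => [||a]; rewrite ?divs_uniq //.
  by rewrite map_inj_in_uniq ?divs_uniq // => a b /inv {2}<- /inv {2}<- ->.
have sub b : subm m b \in divs m.
  by rewrite mem_divs; apply/forallP=> i; rewrite ffunE leq_subr.
by apply/idP/mapP => [am|[b _ ->]] //; exists (subm m a); rewrite ?inv.
Qed.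

Lemma divs_up i m (F : mon n -> R) :
  \sum_(a <- divs (up i m) | (0 < a i)%N) F a = \sum_(a <- divs m) F (up i a).
Proof.
rewrite -big_filter -[RHS](big_map (up i) xpredT F); apply: perm_big.
apply: uniq_perm => [||a].
- by rewrite filter_uniq ?divs_uniq.
- by rewrite (map_inj_uniq (can_inj (upK i))) divs_uniq.
rewrite mem_filter mem_divs; apply/andP/mapP => [[ai /forallP am]|[b]].
  exists (dn i a); rewrite ?dnK // mem_divs; apply/forallP=> l.
  by have := am l; rewrite !ffunE; lia.
rewrite mem_divs => /forallP bm ->; split; first by rewrite ffunE eqxx addn1.
by apply/forallP=> l; rewrite !ffunE leq_add2r.
Qed.

Lemma mulXE j f m : mulX j f m = if (0 < m j)%N then f (dn j m) else 0.
Proof. by []. Qed.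
Lemma dXE i f m : dX i f m = (m i).+1%:R * f (up i m). Proof. by []. Qed.

Lemma smul_mulXl j f g : smul (mulX j f) g = mulX j (smul f g).
Proof.
apply/funext=> m; rewrite smulE mulXE.
have [mj|mj] := ltnP 0 (m j); last first.
  rewrite big_seq big1 // => a; rewrite mem_divs => /forallP /(_ j) aj.
  by rewrite mulXE; case: ifP => ?; [lia|rewrite mul0r].
rewrite -{1 2}(dnK mj) (bigID (fun a : mon n => 0 < a j)%N) /= divs_up.
rewrite [X in _ + X]big1 ?addr0 => [|a /negbTE aj]; last by rewrite mulXE aj mul0r.
rewrite smulE; apply: eq_bigr => a _.
rewrite mulXE ffunE eqxx addn1 upK; congr (_ * g _).
by apply/ffunP=> l; rewrite !ffunE; lia.
Qed.

Lemma smul_mulXr j f g : smul f (mulX j g) = mulX j (smul f g).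
Proof. by rewrite smulC smul_mulXl smulC. Qed.

Lemma smul_dX i f g : dX i (smul f g) = smul (dX i f) g + smul f (dX i g).
Proof.
(* The exponent of [x_i] in the product is the sum of the exponents in the two factors; each summand
   accounts for one term of the Leibniz rule. *)
have sum1 f' g' m :
    \sum_(a <- divs (up i m)) (a i)%:R * (f' a * g' (subm (up i m) a)) = smul (dX i f') g' m.
  rewrite (bigID (fun a : mon n => 0 < a i)%N) /= divs_up.
  rewrite [X in _ + X]big1 ?addr0 => [|a]; last by rewrite lt0n negbK => /eqP ->; rewrite mul0r.
  rewrite smulE; apply: eq_bigr => a _; rewrite dXE ffunE eqxx addn1 mulrA.
  by congr (_ * g' _); apply/ffunP=> l; rewrite !ffunE; lia.
apply/funext=> m; rewrite seriesD -sum1 (smulC f (dX i g)) -sum1.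
have -> : \sum_(a <- divs (up i m)) (a i)%:R * (g a * f (subm (up i m) a))
    = \sum_(a <- divs (up i m)) (subm (up i m) a i)%:R * (f a * g (subm (up i m) a)).
  have inv a : a \in divs (up i m) -> subm (up i m) (subm (up i m) a) = a.
    by rewrite mem_divs => /forallP am; apply/ffunP=> l; move: (am l); rewrite !ffunE => al; rewrite subKn.
  rewrite (perm_big [seq subm (up i m) a | a <- divs (up i m)]) /=.
    rewrite big_map big_seq [RHS]big_seq; apply: eq_bigr => a /inv ->.
    by rewrite [g _ * _]mulrC.
  apply: uniq_perm => [||a]; rewrite ?divs_uniq //.
    by rewrite map_inj_in_uniq ?divs_uniq // => a b /inv {2}<- /inv {2}<- ->.
  have sub b : subm (up i m) b \in divs (up i m).
    by rewrite mem_divs; apply/forallP=> l; rewrite !ffunE leq_subr.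
  by apply/idP/mapP => [am|[b _ ->]] //; exists (subm (up i m) a); rewrite ?inv.
rewrite dXE smulE mulr_sumr -big_split /= big_seq [RHS]big_seq.
apply: eq_bigr => a; rewrite mem_divs => /forallP /(_ i).
rewrite !ffunE eqxx addn1 => ai; rewrite -mulrDl -natrD.
by congr (_%:R * _); lia.
Qed.

Fact mulX_linear j : linear (@mulX R n j).
Proof.
move=> c f g; apply/funext=> m; rewrite seriesD seriesZ !mulXE.
by case: ifP => // _; rewrite mulr0 addr0.
Qed.
HB.instance Definition _ j :=
  GRing.isLinear.Build R (series R n) (series R n) *:%R (@mulX R n j) (mulX_linear j).

Fact dX_linear j : linear (@dX R n j).
Proof.
by move=> c f g; apply/funext=> m; rewrite seriesD seriesZ !dXE seriesD seriesZ; ring.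
Qed.
HB.instance Definition _ j :=
  GRing.isLinear.Build R (series R n) (series R n) *:%R (@dX R n j) (dX_linear j).

Lemma mulXZ j c f : mulX j (c *: f) = c *: mulX j f. Proof. exact: linearZ. Qed.
Lemma dXZ j c f : dX j (c *: f) = c *: dX j f. Proof. exact: linearZ. Qed.

Lemma mulXD j f g : mulX j (f + g) = mulX j f + mulX j g. Proof. exact: linearD. Qed.

Lemma DopE A f : Dop A f = \sum_i \sum_j A i j *: mulX j (dX i f).
Proof.
apply/funext=> m; rewrite series_sum; apply: eq_bigr => i _.
by rewrite series_sum.
Qed.

Fact Dop_linear A : linear (Dop A : series R n -> series R n).
Proof.
move=> c f g; rewrite !DopE scaler_sumr -big_split /=; apply: eq_bigr => i _.
rewrite scaler_sumr -big_split /=; apply: eq_bigr => j _.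
by rewrite (linearP (@dX R n i)) (linearP (@mulX R n j)) scalerDr !scalerA mulrC.
Qed.
HB.instance Definition _ A :=
  GRing.isLinear.Build R (series R n) (series R n) *:%R (Dop A) (Dop_linear A).

Fact smul_linear f : linear (smul f).
Proof.
move=> c g h; apply/funext=> m; rewrite seriesD seriesZ !smulE mulr_sumr -big_split /=.
by apply: eq_bigr => a _; rewrite seriesD seriesZ; ring.
Qed.
HB.instance Definition _ f :=
  GRing.isLinear.Build R (series R n) (series R n) *:%R (smul f) (smul_linear f).

Lemma Dop_smul A f g : Dop A (smul f g) = smul (Dop A f) g + smul f (Dop A g).
Proof.
rewrite [smul (Dop A f) g]smulC !DopE !linear_sum -big_split /=; apply: eq_bigr => i _.
rewrite !linear_sum -big_split /=; apply: eq_bigr => j _.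
rewrite !linearZ /= -scalerDr smul_dX linearD /=.
by rewrite !smul_mulXr [smul g _]smulC.
Qed.

Lemma Dop_sone A : Dop A (@sone R n) = 0.
Proof.
rewrite DopE big1 // => i _; rewrite big1 // => j _.
suff -> : dX i (@sone R n) = 0 by rewrite linear0 scaler0.
apply/funext=> m; rewrite dXE /sone.
have /negbTE -> : up i m != [ffun=> 0%N]; last by rewrite mulr0.
by apply/eqP => /ffunP /(_ i); rewrite !ffunE eqxx addn1.
Qed.

Lemma mulXC i j f : mulX i (mulX j f) = mulX j (mulX i f).
Proof.
apply/funext=> m; rewrite !mulXE; have [->//|ij] := eqVneq i j.
rewrite !ffunE (negbTE ij) eq_sym (negbTE ij) !subn0.
case: ifP => // _; case: ifP => // _; congr f.
by apply/ffunP=> l; rewrite !ffunE; lia.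
Qed.

Lemma dXC i j f : dX i (dX j f) = dX j (dX i f).
Proof.
apply/funext=> m; rewrite !dXE; have [->//|ij] := eqVneq i j.
rewrite !ffunE [j == i]eq_sym (negbTE ij) !addn0 !mulrA [X in X * _]mulrC; congr (_ * f _).
by apply/ffunP=> l; rewrite !ffunE; lia.
Qed.

Lemma dX_mulX i j f : dX i (mulX j f) = mulX j (dX i f) + (i == j)%:R *: f.
Proof.
apply/funext=> m; rewrite seriesD seriesZ !(mulXE, dXE).
have [<-|ij] := eqVneq i j.
  rewrite ffunE eqxx addn1 upK; have [mi|mi] := ltnP 0 (m i).
    by rewrite dnK // ffunE eqxx mul1r subn1 prednK // -(natr1 (m i)) mulrDl mul1r.
  by rewrite (_ : m i = 0%N) ?add0r //; lia.
rewrite ffunE [j == i]eq_sym (negbTE ij) addn0 mul0r addr0.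
case: ifP => mj; last by rewrite mulr0.
rewrite ffunE (negbTE ij) subn0; congr (_ * f _).
by apply/ffunP=> l; rewrite !ffunE; case: (eqVneq l j) => [->|]; lia.
Qed.

(** The first-order part arises when [dX i] differentiates the factor [x_l] of [Dop B f]. The
    second-order part is unchanged when [A] and [B] are swapped, so it cancels in the commutator,
    which reverses the order of the matrices. *)
Lemma Dop_comp A B f : Dop A (Dop B f) = Dop (B *m A) f +
  \sum_i \sum_j \sum_k \sum_l (A i j * B k l) *: mulX j (mulX l (dX i (dX k f))).
Proof.
rewrite !DopE.
have -> : \sum_i \sum_j (B *m A) i j *: mulX j (dX i f) =
    \sum_i \sum_j \sum_k \sum_l (A i j * B k l) *: ((i == l)%:R *: mulX j (dX k f)).
  rewrite exchange_big [RHS]exchange_big; apply: eq_bigr => j _ /=.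
  rewrite [RHS]exchange_big; apply: eq_bigr => k _ /=.
  rewrite mxE scaler_suml; apply: eq_bigr => i _; rewrite (bigD1 i) //= eqxx scale1r.
  rewrite big1 ?addr0 1?mulrC // => l /negbTE li.
  by rewrite eq_sym li scale0r scaler0.
do 2![rewrite -big_split; apply: eq_bigr => ? _ /=].
rewrite !linear_sum -big_split; apply: eq_bigr => ? _ /=.
rewrite !linear_sum -big_split; apply: eq_bigr => ? _ /=.
by rewrite dXZ mulXZ scalerA -scalerDr dX_mulX mulXD [mulX _ (_%:R *: _)]mulXZ addrC.
Qed.

Lemma Dop_comm A B f : Dop A (Dop B f) - Dop B (Dop A f) = Dop (B *m A - A *m B) f.
Proof.
have DB C D : Dop (C - D) f = Dop C f - Dop D f.
  rewrite !DopE -sumrB; apply: eq_bigr => i _; rewrite -sumrB; apply: eq_bigr => j _.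
  by rewrite !mxE scalerBl.
rewrite !Dop_comp DB opprD addrACA; set S1 := \sum_i _; set S2 := \sum_i _.
suff -> : S1 = S2 by rewrite subrr addr0.
rewrite /S1 /S2 pair_big exchange_big /=.
under eq_bigr do rewrite exchange_big /=.
apply: eq_bigr => k _.
under eq_bigr => l _ do rewrite -(pair_big xpredT xpredT (fun i j => (A i j * B k l) *: mulX j (mulX l (dX i (dX k f))))) /=.
do 3![apply: eq_bigr => ? _].
by rewrite mulrC mulXC dXC.
Qed.

(** A linear vector field preserves degrees. Hence a countable combination may be replaced by a
    finite truncation in each degree before applying the operators. *)
Lemma Dop_local A d f g : (forall m, mdeg m = d -> f m = g m) ->
  forall m, mdeg m = d -> Dop A f m = Dop A g m.
Proof.
move=> fg m md; apply: eq_bigr => i _; apply: eq_bigr => j _; congr (_ * _).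
rewrite !mulXE; case: ifP => // mj; rewrite !dXE fg //.
by rewrite mdeg_up mdeg_dn.
Qed.

Lemma iter_Dop_local A d f g K : (forall m, mdeg m = d -> f m = g m) ->
  forall m, mdeg m = d -> iter K (Dop A) f m = iter K (Dop A) g m.
Proof. by move=> fg; elim: K => //= K IH; apply: Dop_local. Qed.

Lemma DopZ c A f : Dop (c *: A) f = c *: Dop A f.
Proof.
rewrite !DopE scaler_sumr; apply: eq_bigr => i _; rewrite scaler_sumr.
by apply: eq_bigr => j _; rewrite !mxE scalerA.
Qed.

Lemma homogeneous_smul f g : homogeneous f -> homogeneous g -> homogeneous (smul f g).
Proof.
move=> [d fd] [e ge]; exists (d + e)%N => m; apply: contra_neq_eq => mde.
rewrite smulE big_seq big1 // => a; rewrite mem_divs => /forallP am.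
have [->|/fd ad] := eqVneq (f a) 0; first by rewrite mul0r.
have [->|/ge ae] := eqVneq (g (subm m a)) 0; first by rewrite mulr0.
case/eqP: mde; rewrite -ad -ae /mdeg -big_split; apply: eq_bigr => i _.
by rewrite [subm m a i]ffunE /= subnKC.
Qed.

Lemma homogeneous_sone : homogeneous (@sone R n).
Proof.
exists 0%N => m; rewrite /sone; have [->|] := eqVneq m; last by rewrite eqxx.
by rewrite /mdeg big1 // => i _; rewrite ffunE.
Qed.

End Series.

(** * Highest weight vectors in an abstract sl2-module, for use with series and with column
    vectors *)

Section Sl2.
Variables (R : realType) (V : lmodType R) (X Y Z : {linear V -> V}) (v : V) (w : nat).
Hypothesis XY : forall u, X (Y u) = Y (X u) + Z u.
Hypothesis ZY : forall u, Z (Y u) = Y (Z u) - 2 *: Y u.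
Hypotheses (Xv : X v = 0) (Zv : Z v = w%:R *: v).

Lemma sl2_weight i : Z (iter i Y v) = (w%:R - 2 * i%:R) *: iter i Y v.
Proof.
elim: i => [|i IH] /=; first by rewrite Zv mulr0 subr0.
by rewrite ZY IH linearZ -scalerBl; congr (_ *: _); rewrite -natr1; ring.
Qed.

(** Moving [X] past the copies of [Y] collects the weights [w - 2 j] for [j] from [0] to [i], whose
    sum is [(i + 1) (w - i)]. *)
Lemma sl2_raise i : X (iter i.+1 Y v) = (i.+1%:R * (w%:R - i%:R)) *: iter i Y v.
Proof.
elim: i => [|i IH]; first by rewrite /= XY Xv linear0 add0r Zv subr0 mul1r.
rewrite iterS XY IH linearZ sl2_weight -scalerDl -!natr1.
by congr (_ *: _); ring.
Qed.

(** The scalar by which [X^K Y^K] acts on [v]. It is nonzero for [K <= w] and contains the zero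
    factor [w - w] otherwise. *)
Definition sl2_coef (K : nat) : R := \prod_(i < K) (i.+1%:R * (w%:R - i%:R)).

Lemma sl2_coef_neq0 K : (K <= w)%N -> sl2_coef K != 0.
Proof.
move=> Kw; apply/prodf_neq0 => i _; rewrite mulf_neq0 ?pnatr_eq0 //.
by rewrite subr_eq0 eqr_nat; have := ltn_ord i; lia.
Qed.

Lemma sl2_iterXY K : iter K X (iter K Y v) = sl2_coef K *: v.
Proof.
rewrite /sl2_coef; elim: K => [|K IH]; first by rewrite big_ord0 scale1r.
have iterZ c u : iter K X (c *: u) = c *: iter K X u.
  by elim: K {IH} => //= K ->; rewrite linearZ.
by rewrite iterSr sl2_raise iterZ IH scalerA big_ord_recr mulrC.
Qed.

Lemma sl2_iterXY_lt K s : (s < K)%N -> iter K X (iter s Y v) = 0.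
Proof.
move=> sK; rewrite -(subnK sK) addnS -addSn iterD sl2_iterXY iterSr linearZ /= Xv scaler0.
by elim: (K - s.+1)%N => //= k ->; rewrite linear0.
Qed.

End Sl2.

(** * Iterates of the derivations, and weights of products *)

Section Linear.
Variables (R : realType) (n : nat).
Implicit Types (f g h : series R n) (m : mon n) (A B : 'M[R]_n).

Lemma iter_Dop_sum A K I (s : seq I) (c : I -> R) (F : I -> series R n) :
  iter K (Dop A) (\sum_(i <- s) c i *: F i) = \sum_(i <- s) c i *: iter K (Dop A) (F i).
Proof.
elim: K => //= K ->; rewrite linear_sum; apply: eq_bigr => i _.
exact: linearZ.
Qed.

Lemma iter_DopZ A K c f : iter K (Dop A) (c *: f) = c *: iter K (Dop A) f.
Proof. by elim: K => //= K ->; rewrite linearZ. Qed.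

Lemma iter_DopB A K f g : iter K (Dop A) (f - g) = iter K (Dop A) f - iter K (Dop A) g.
Proof. by elim: K => //= K ->; rewrite linearB. Qed.

Lemma iter_Dop0 A K : iter K (Dop A) 0 = 0 :> series R n.
Proof. by elim: K => //= K ->; rewrite linear0. Qed.

Definition wvec A B f (w : nat) := Dop A f = 0 /\ Dop B f = w%:R *: f.

Lemma wvec_smul A B f g w1 w2 : wvec A B f w1 -> wvec A B g w2 ->
  wvec A B (smul f g) (w1 + w2).
Proof.
move=> [Af Bf] [Ag Bg]; split; rewrite Dop_smul.
  by rewrite Af Ag smulC !linear0 addr0.
by rewrite Bf Bg smulC !linearZ /= smulC -scalerDl natrD.
Qed.

Lemma wvec_amono A B p (alpha : 'I_p -> series R n) (ahat : 'I_p -> nat) k :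
  (forall i, wvec A B (alpha i) (ahat i)) ->
  wvec A B (amono alpha k) (wdot ahat k).
Proof.
move=> wa; have w1 : wvec A B (@sone R n) 0 by split; rewrite Dop_sone ?scale0r.
have ws i : wvec A B (spow (alpha i) (k i)) (ahat i * k i).
  rewrite /spow; elim: (k i) => [|e IH]; first by rewrite muln0.
  by rewrite mulnS; apply: wvec_smul.
rewrite /amono /wdot -big_enum /=.
elim: (enum 'I_p) => [|i s IH]; first by rewrite big_nil.
by rewrite big_cons; apply: wvec_smul.
Qed.

Lemma homogeneous_amono p (alpha : 'I_p -> series R n) k :
  (forall i, homogeneous (alpha i)) -> homogeneous (amono alpha k).
Proof.
move=> ha; rewrite /amono; elim: (enum 'I_p) => [|i s IH]; first exact: homogeneous_sone.
apply: homogeneous_smul => //; elim: (k i) => [|e IHe]; first exact: homogeneous_sone.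
exact: homogeneous_smul.
Qed.

End Linear.

(** * The weighted Fischer inner product *)

Section Fischer.
Variables (R : realType) (n : nat) (rho : 'I_n -> R).
Hypothesis rho_gt0 : forall i, 0 < rho i.
Implicit Types (f g h : series R n) (m : mon n) (A B : 'M[R]_n).

(** For [rho = 1] this is the classical Fischer norm, for which the adjoint of [Dop A] is [Dop A^T].
    The matrices of [X] and [Y] are transposes only up to a diagonal rescaling, which [rho]
    supplies. *)
Definition fwt m : R := \prod_i ((m i)`!%:R * rho i ^+ m i).

Definition fischer (d : nat) f g : R := \sum_(m <- mons n d) fwt m * (f m * g m).

Lemma fwt_gt0 m : 0 < fwt m.
Proof. by apply: prodr_gt0 => i _; rewrite mulr_gt0 ?exprn_gt0 // ltr0n fact_gt0. Qed.

Lemma fwt_up i m : fwt (up i m) = fwt m * (rho i * (m i).+1%:R).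
Proof.
rewrite /fwt (bigD1 i) // [in RHS](bigD1 i) //= ffunE eqxx addn1 factS natrM exprS.
rewrite (eq_bigr (fun l => (m l)`!%:R * rho l ^+ m l)); first by ring.
by move=> l /negbTE li; rewrite ffunE li addn0.
Qed.

Lemma mons_up i d (F : mon n -> R) :
  \sum_(m <- mons n d.+1 | (0 < m i)%N) F m = \sum_(m <- mons n d) F (up i m).
Proof.
rewrite -big_filter -[RHS](big_map (up i) xpredT F); apply: perm_big.
apply: uniq_perm => [||a].
- by rewrite filter_uniq ?mons_uniq.
- by rewrite (map_inj_uniq (can_inj (upK i))) mons_uniq.
rewrite mem_filter mem_mons; apply/andP/mapP => [[ai ad]|[b]].
  by exists (dn i a); rewrite ?dnK // mem_mons -eqSS mdeg_dn.
rewrite mem_mons => bd ->; split; first by rewrite ffunE eqxx addn1.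
by rewrite mdeg_up eqSS.
Qed.

Lemma fischerC d f g : fischer d f g = fischer d g f.
Proof. by apply: eq_bigr => m _; rewrite [f m * _]mulrC. Qed.

Lemma fischer_suml d I (s : seq I) (Q : pred I) (F : I -> series R n) g :
  fischer d (\sum_(i <- s | Q i) F i) g = \sum_(i <- s | Q i) fischer d (F i) g.
Proof.
rewrite exchange_big; apply: eq_bigr => m _.
by rewrite series_sum mulr_suml mulr_sumr.
Qed.

Lemma fischerZl d c f g : fischer d (c *: f) g = c * fischer d f g.
Proof. by rewrite mulr_sumr; apply: eq_bigr => m _; rewrite seriesZ; ring. Qed.

Lemma fischerDr d f g h : fischer d f (g + h) = fischer d f g + fischer d f h.
Proof.
by rewrite -big_split; apply: eq_bigr => m _; rewrite seriesD mulrDr mulrDr.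
Qed.

Lemma eq_fischerr d f g h : (forall m, mdeg m = d -> g m = h m) ->
  fischer d f g = fischer d f h.
Proof.
move=> gh; rewrite /fischer big_seq [RHS]big_seq; apply: eq_bigr => m.
by rewrite mem_mons => /eqP /gh ->.
Qed.

Lemma fischer_eq0 d f : fischer d f f = 0 -> forall m, mdeg m = d -> f m = 0.
Proof.
move=> /eqP; rewrite psumr_eq0 => [/allP f0 m /eqP|m _]; last first.
  by rewrite mulr_ge0 ?(ltW (fwt_gt0 m)) // -expr2 sqr_ge0.
rewrite -mem_mons => /f0 /=; rewrite mulf_eq0 gt_eqF ?fwt_gt0 //=.
by rewrite mulf_eq0 orbb => /eqP.
Qed.

(** Apart from the factor [rho j], the right side is symmetric under exchanging [(i, f)] with
    [(j, g)]; adjointness follows from this. *)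
Lemma fischer_mulX_dX i j d f g : fischer d.+1 (mulX j (dX i f)) g =
  rho j * \sum_(m <- mons n d)
    fwt m * ((m i).+1%:R * f (up i m)) * ((m j).+1%:R * g (up j m)).
Proof.
rewrite /fischer (bigID (fun m : mon n => 0 < m j)%N) /= mons_up.
rewrite [X in _ + X]big1 ?addr0 => [|a /negbTE aj]; last by rewrite mulXE aj mul0r mulr0.
rewrite mulr_sumr; apply: eq_bigr => m _.
by rewrite mulXE ffunE eqxx addn1 /= upK dXE fwt_up; ring.
Qed.

(* Up to the weights, multiplication by [x_j] is adjoint to [d_j]. *)
Lemma fischer_adj A B d f g : (forall i j, A i j * rho j = B j i * rho i) ->
  fischer d (Dop A f) g = fischer d f (Dop B g).
Proof.
move=> AB; rewrite [RHS]fischerC !DopE exchange_big /=.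
rewrite !fischer_suml; apply: eq_bigr => j _; rewrite !fischer_suml; apply: eq_bigr => i _.
rewrite !fischerZl; case: d => [|d].
  have z h h' l : fischer 0 (mulX l h) h' = 0.
    rewrite /fischer big_seq big1 // => m; rewrite mem_mons mulXE => /eqP m0.
    by have := leq_mdeg m l; rewrite m0 leqn0 => /eqP ->; rewrite mul0r mulr0.
  by rewrite !z !mulr0.
rewrite !fischer_mulX_dX !mulrA AB; congr (_ * _); apply: eq_bigr => m _; ring.
Qed.

Lemma fischer_eigen A d f g (a b : R) : (forall i j, A i j * rho j = A j i * rho i) ->
  Dop A f = a *: f -> Dop A g = b *: g -> a != b -> fischer d f g = 0.
Proof.
move=> AA Af Ag ab; have := fischer_adj d f g AA.
rewrite Af Ag fischerZl fischerC [RHS]fischerC fischerZl fischerC => /eqP.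
by rewrite -subr_eq0 -mulrBl mulf_eq0 subr_eq0 (negbTE ab) => /eqP; rewrite fischerC.
Qed.

End Fischer.

(** * Countable combinations, degree by degree *)

Section Dcomb.
Variables (R : realType) (n : nat) (I : eqType).

(* Formal combinations with the finite support chosen uniformly in each degree, so that they
   are preserved by the operators [Dop A]. *)
Definition dcomb (P : I -> Prop) (v : I -> series R n) (c : I -> R) (f : series R n) :=
  forall d, exists s : seq I,
    [/\ uniq s, (forall i, i \in s -> P i),
        (forall i m, P i -> mdeg m = d -> c i * v i m != 0 -> i \in s) &
        (forall m, mdeg m = d -> f m = \sum_(i <- s) c i * v i m)].

Lemma big_uniq_subset (s1 s2 : seq I) (F : I -> R) : uniq s1 -> uniq s2 ->
  {subset s1 <= s2} -> (forall i, i \in s2 -> i \notin s1 -> F i = 0) ->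
  \sum_(i <- s1) F i = \sum_(i <- s2) F i.
Proof.
move=> u1 u2 s12 F0; rewrite [RHS](bigID (mem s1)) /= [X in _ + X]big_seq_cond.
rewrite [X in _ + X]big1 ?addr0 => [|i /andP[]]; last exact: F0.
rewrite -[RHS]big_filter; apply/perm_big/uniq_perm => [||i]; rewrite ?filter_uniq //.
by rewrite mem_filter /= andb_idr //; apply: s12.
Qed.

(** A degree contains finitely many monomials, so the union of their finite supports is again
    finite. *)
Lemma fcomb_dcomb P (v : I -> series R n) f : fcomb P v f -> exists c, dcomb P v c f.
Proof.
case=> c /choice[S HS]; exists c => d.
exists (undup (flatten [seq S m | m <- mons n d])).
have memS m i : mdeg m = d -> i \in S m -> i \in undup (flatten [seq S m | m <- mons n d]).
  move=> md iS; rewrite mem_undup; apply/flattenP; exists (S m) => //.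
  by rewrite map_f // mem_mons md.
split=> [|i|i m Pi md ci|m md]; first exact: undup_uniq.
- rewrite mem_undup => /flattenP[_ /mapP[m _ ->]].
  by have [_ H _ _] := HS m; apply: H.
- by have [_ _ H _] := HS m; apply: (memS m) => //; apply: H.
have [uS PS cS ->] := HS m; apply: big_uniq_subset => [||i|i]; rewrite ?undup_uniq //.
  exact: memS.
rewrite mem_undup => /flattenP[_ /mapP[m' _ ->]] im'; apply: contraNeq => ci.
by apply: cS => //; have [_ H _ _] := HS m'; apply: H.
Qed.

End Dcomb.

(** * The formal basis of [ker X^K] *)

Section FormalBasis.
Variables (R : realType) (n : nat) (A B C : 'M[R]_n) (rho : 'I_n -> R).
Hypothesis rho_gt0 : forall i, 0 < rho i.
Hypothesis comAB : B *m A - A *m B = C.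
Hypothesis comBC : B *m C - C *m B = - 2 *: B.
Hypothesis adjAB : forall i j, A i j * rho j = B j i * rho i.
Hypothesis adjC : forall i j, C i j * rho j = C j i * rho i.
Local Notation X := (Dop A).
Local Notation Y := (Dop B).
Local Notation Z := (Dop C).
Implicit Types (f g h : series R n) (m : mon n).

Lemma Dop_XY f : X (Y f) = Y (X f) + Z f.
Proof. by apply/eqP; rewrite addrC -subr_eq Dop_comm comAB. Qed.

Lemma Dop_ZY f : Z (Y f) = Y (Z f) - 2 *: Y f.
Proof. by apply/eqP; rewrite addrC -subr_eq Dop_comm comBC DopZ scaleNr. Qed.

Lemma adjBA i j : B i j * rho j = A j i * rho i. Proof. by rewrite adjAB. Qed.

Lemma fischer_iterX d K f g :
  fischer rho d (iter K X f) g = fischer rho d f (iter K Y g).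
Proof. by elim: K g => //= K IH g; rewrite (fischer_adj _ _ _ adjAB) IH -iterSr. Qed.

(** By adjointness the square norm of [Y^(w+1) f] is the product of [Y^w f] with [X Y^(w+1) f], and
    the latter carries the factor [w - w]. Positivity in every degree then gives [Y^(w+1) f = 0]. *)
Lemma iterY_gt_weight f w K : wvec A C f w -> (w < K)%N -> iter K Y f = 0.
Proof.
move=> [Xf Zf] wK; rewrite -(subnK wK) iterD.
suff -> : iter w.+1 Y f = 0 by apply: iter_Dop0.
apply/funext=> m; apply: (fischer_eq0 rho_gt0 _ (erefl (mdeg m))).
rewrite {1}iterS (fischer_adj _ _ _ adjBA) (sl2_raise Dop_XY Dop_ZY Xf Zf) subrr mulr0.
by rewrite fischerC fischerZl mul0r.
Qed.

Variables (I : eqType) (P : I -> Prop) (alpha : I -> series R n) (wt : I -> nat).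
Hypothesis alpha_hom : forall i, P i -> homogeneous (alpha i).
Hypothesis alpha_wt : forall i, P i -> wvec A C (alpha i) (wt i).
Hypothesis alpha_free : lin_indep P alpha.
Hypothesis alpha_span : forall f, X f = 0 -> fcomb P alpha f.

(* A highest weight vector of weight [< K] is killed by [Y^K], hence orthogonal to the image
   of [X^K]. *)
Lemma image_weight K g c : dcomb P alpha c (iter K X g) ->
  forall i, P i -> (wt i < K)%N -> c i = 0.
Proof.
move=> cg k0 Pk0 wk0; apply: contrapT => /eqP ck0.
(* Independence of a single vector excludes [alpha k0 = 0]. The rest takes place in the degree of
   [m0]. *)
have [m0 am0] : exists m, alpha k0 m != 0.
  apply: contrapT => /forallNP a0.
  suff /eqP : 1 = 0 :> R by rewrite oner_eq0.
  apply: (alpha_free (s := [:: k0]) (c := fun=> 1) _ _ _ (mem_head _ _)) => // [i|m].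
    by rewrite inE => /eqP ->.
  by rewrite big_seq1 mul1r; apply/eqP/negPn/negP/a0.
set d := mdeg m0; have [S [uS PS cS gS]] := cg d.
have k0S : k0 \in S by apply: (cS _ m0) => //; rewrite mulf_neq0.
(* [q] selects the terms of low weight that live in degree [d]. By homogeneity they vanish in all
   other degrees, so a relation among them in degree [d] is a relation between series. *)
pose q k := (wt k < K)%N && has (fun m => alpha k m != 0) (mons n d).
have qP k m : q k -> P k -> mdeg m != d -> alpha k m = 0.
  move=> /andP[_ /hasP[m1]]; rewrite mem_mons => /eqP <- am1 Pk; apply: contraNeq => am.
  by have [e ae] := alpha_hom Pk; rewrite (ae _ am) (ae _ am1).
pose h := \sum_(k <- S | q k) c k *: alpha k.
pose h' := \sum_(k <- S | ~~ q k) c k *: alpha k.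
have Xh : forall m, mdeg m = d -> iter K X g m = (h + h') m.
  move=> m md; rewrite gS // seriesD /h /h' !series_sum (bigID q) /=.
  by congr (_ + _); apply: eq_bigr => k _; rewrite seriesZ.
have Yh : iter K Y h = 0.
  rewrite /h -big_filter iter_Dop_sum big_seq big1 // => k.
  rewrite mem_filter => /andP[/andP[wk _] kS].
  by rewrite (iterY_gt_weight (alpha_wt (PS _ kS)) wk) scaler0.
(* A term of [h'] either has weight at least [K], hence a weight not occurring in [h], or vanishes
   in degree [d]. *)
have hh' : fischer rho d h h' = 0.
  rewrite /h big_seq_cond fischer_suml big1 // => k /and3P[kS wk _].
  rewrite fischerZl fischerC /h' big_seq_cond fischer_suml big1 ?mulr0 // => l /andP[lS].
  rewrite negb_and -leqNgt => /orP[wl|/hasPn al].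
    rewrite fischerZl (@fischer_eigen _ _ _ C _ _ _ (wt l)%:R (wt k)%:R) ?mulr0 //.
    - by have [] := alpha_wt (PS _ lS).
    - by have [] := alpha_wt (PS _ kS).
    by rewrite eqr_nat gtn_eqF // (leq_trans wk).
  rewrite fischerZl fischerC (@eq_fischerr _ _ _ _ _ _ 0) => [|m /eqP].
    by rewrite -(scale0r 0) fischerC fischerZl mul0r mulr0.
  by rewrite -mem_mons => /al; rewrite negbK => /eqP.
(* Since [h'] is orthogonal to [h], the square norm of [h] is its product with [X^K g], that is, the
   product of [Y^K h = 0] with [g]. *)
have hh : fischer rho d h h = 0.
  have := eq_fischerr rho h Xh; rewrite fischerDr hh' addr0 => <-.
  by rewrite fischerC fischer_iterX Yh -(scale0r 0) fischerC fischerZl mul0r.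
move/eqP: ck0; apply; apply: (alpha_free (s := filter q S)).
- by rewrite filter_uniq.
- by move=> i; rewrite mem_filter => /andP[_ /PS].
- move=> m; rewrite big_filter; have [md|md] := eqVneq (mdeg m) d.
    by have := fischer_eq0 rho_gt0 hh md; rewrite /h series_sum.
  rewrite big_seq_cond big1 // => k /andP[kS qk].
  by rewrite (qP k) ?mulr0 //; apply: PS.
rewrite mem_filter k0S andbT /q wk0; apply/hasP; exists m0 => //.
by rewrite mem_mons.
Qed.

Lemma ker_iterX_span K g : iter K X g = 0 ->
  exists c, dcomb (fun t : I * nat => [/\ P t.1, (t.2 <= wt t.1)%N & (t.2 < K)%N])
    (fun t => iter t.2 Y (alpha t.1)) c g.
Proof.
elim: K g => [|K IH] g.
  move=> /= ->; exists (fun=> 0) => d; exists [::]; split=> // [i m _ _|m _].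
    by rewrite mul0r eqxx.
  by rewrite big_nil.
rewrite iterS => /alpha_span /fcomb_dcomb[c cg].
have c0 := image_weight cg.
have /choice[S HS] := cg.
(* For [wt k < K] the divisor is zero, but then [c k = 0] by [image_weight], so multiplying back
   gives [c k] in every case. *)
pose a k := c k / sl2_coef R (wt k) K.
have aE k : P k -> a k * sl2_coef R (wt k) K = c k.
  move=> Pk; rewrite /a; have [Kw|wK] := leqP K (wt k); first by rewrite divfK ?sl2_coef_neq0.
  by rewrite c0 // !mul0r.
(* The series to subtract is an infinite combination. [G d] is a finite sum with the right
   coefficients in degree [d], and [g1] glues the corrected degrees together. *)
pose G d := \sum_(k <- S d) a k *: iter K Y (alpha k).
pose g1 : series R n := fun m => g m - G (mdeg m) m.
have /IH[c1 Hc1] : iter K X g1 = 0.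
  apply/funext=> m; set d := mdeg m.
  have -> : iter K X g1 m = iter K X (g - G d) m.
    by apply: (@iter_Dop_local _ _ _ d) => // m' md; rewrite /g1 md.
  have [_ PS _ gS] := HS d.
  rewrite iter_DopB; apply/eqP; rewrite subr_eq0 gS // iter_Dop_sum series_sum; apply/eqP.
  rewrite big_seq [RHS]big_seq; apply: eq_bigr => k kS.
  have [Xk Zk] := alpha_wt (PS _ kS).
  by rewrite (sl2_iterXY Dop_XY Dop_ZY Xk Zk) scalerA aE ?seriesZ //; apply: PS.
(* The induction hypothesis only uses exponents below [K], so the new indices do not collide with
   the old ones. *)
exists (fun t => if t.2 == K then a t.1 else c1 t) => d.
have [s1 [us1 Ps1 cs1 gs1]] := Hc1 d; have [uS PS cS _] := HS d.
have s1K t : t \in s1 -> (t.2 == K) = false by move=> /Ps1[_ _ /ltn_eqF].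
exists (s1 ++ [seq (k, K) | k <- S d & (K <= wt k)%N]); split.
- rewrite cat_uniq us1 map_inj_uniq ?filter_uniq // => [|x y [] //].
  by rewrite andbT; apply/hasPn => _ /mapP[k _ ->]; apply/negP => /s1K; rewrite eqxx.
- move=> t; rewrite mem_cat => /orP[/Ps1[? ? tK]|/mapP[k]].
    by split=> //; apply: ltnW.
  by rewrite mem_filter => /andP[Kw /PS Pk] -> /=.
- move=> [k s] m [/= Pk sw sK] md; rewrite mem_cat.
  have [->|sK'] := eqVneq s K => ck; last first.
    by rewrite (cs1 _ m) //=; split => //; rewrite ltn_neqAle sK'.
  apply/orP; right; apply/mapP; exists k => //; rewrite mem_filter.
  have [Kw|wK] := leqP K (wt k); last by rewrite /a c0 // !mul0r eqxx in ck.
  (* For [k] outside [S d], the series [c k *: alpha k] vanishes in degree [d], and so does its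
     image under [Y^K]. *)
  apply: contraNT ck => kS; rewrite /a mulrAC -seriesZ.
  rewrite -iter_DopZ (@iter_Dop_local _ _ _ d _ 0) ?iter_Dop0 ?mul0r // => m' md'.
  rewrite seriesZ; apply: contraNeq kS => ck'.
  exact: cS ck'.
move=> m md; rewrite big_cat big_map big_filter /=.
have -> : g m = g1 m + G d m by rewrite /g1 md subrK.
rewrite gs1 // /G series_sum; congr (_ + _).
  by rewrite big_seq [RHS]big_seq; apply: eq_bigr => t /s1K ->.
rewrite [LHS](bigID (fun k => K <= wt k)%N) /= [X in _ + X]big_seq_cond.
rewrite [X in _ + X]big1 ?addr0 => [|k /andP[/PS Pk]]; last first.
  by rewrite -ltnNge => wK; rewrite /a c0 // mul0r scale0r.
by apply: eq_bigr => k _; rewrite eqxx.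
Qed.

Lemma iterY_free : lin_indep (fun t : I * nat => P t.1 /\ (t.2 <= wt t.1)%N)
  (fun t => iter t.2 Y (alpha t.1)).
Proof.
move=> s c; have [K] : exists K, forall t, t \in s -> (t.2 < K)%N.
  exists (\max_(t <- s) t.2).+1 => t ts; rewrite ltnS.
  by rewrite (big_rem t) //= leq_maxl.
elim: K s => [|K IH] s sK us Ps s0 t ts; first by have := sK t ts.
have s0' : \sum_(t <- s) c t *: iter t.2 Y (alpha t.1) = 0.
  by apply/funext=> m; rewrite series_sum -[RHS](s0 m).
(* [X^K] kills the terms with exponent below [K] and turns those with exponent [K] into nonzero
   multiples of the [alpha k], which are independent. *)
have cK k : (k, K) \in s -> c (k, K) = 0.
  move=> ks; have [/= Pk Kw] := Ps _ ks.
  suff /eqP : c (k, K) * sl2_coef R (wt k) K = 0.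
    by rewrite mulf_eq0 (negbTE (sl2_coef_neq0 R Kw)) orbF => /eqP.
  pose sK' := [seq t.1 | t <- s & t.2 == K].
  apply: (alpha_free (s := sK') (c := fun k => c (k, K) * sl2_coef R (wt k) K)).
  - rewrite map_inj_in_uniq ?filter_uniq // => -[k1 s1] [k2 s2].
    by rewrite !mem_filter /= => /andP[/eqP -> _] /andP[/eqP -> _] ->.
  - by move=> i /mapP[u]; rewrite mem_filter => /andP[_ /Ps[Pu _]] ->.
  - move=> m; rewrite big_map big_filter.
    have := congr1 (fun f => iter K X f m) s0'; rewrite iter_Dop_sum iter_Dop0 series_sum => e.
    rewrite -[RHS]e [RHS](bigID (fun t => t.2 == K)) /= [X in _ + X]big_seq_cond.
    rewrite [X in _ + X]big1 ?addr0 => [|u /andP[us' uK]].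
      rewrite big_seq_cond [RHS]big_seq_cond; apply: eq_bigr => -[k1 s1] /andP[/Ps[/= Pk1 _]].
      move=> /eqP ->; have [Xk Zk] := alpha_wt Pk1.
      by rewrite (sl2_iterXY Dop_XY Dop_ZY Xk Zk) !seriesZ mulrA.
    have [Pu _] := Ps _ us'; have [Xk Zk] := alpha_wt Pu.
    by rewrite (sl2_iterXY_lt Dop_XY Dop_ZY Xk Zk) ?scaler0 // ltn_neqAle uK -ltnS sK.
  by apply/mapP; exists (k, K); rewrite // mem_filter eqxx.
have [tK|tK] := eqVneq t.2 K.
  by move: ts; case: t tK => k r /= ->; apply: cK.
apply: (IH [seq t <- s | t.2 != K]).
- by move=> u; rewrite mem_filter => /andP[uK /sK]; rewrite ltnS ltn_neqAle uK.
- by rewrite filter_uniq.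
- by move=> u; rewrite mem_filter => /andP[_ /Ps].
- move=> m; rewrite big_filter -[RHS](s0 m) [RHS](bigID (fun t => t.2 == K)) /=.
  rewrite [X in X + _]big_seq_cond [X in X + _]big1 ?add0r // => -[k r] /andP[ks /eqP /= rK].
  by move: ks; rewrite rK => /cK ->; rewrite mul0r.
by rewrite mem_filter tK.
Qed.

End FormalBasis.

(** * Transvectants lie in the kernel *)

Section Transvectant.
Variables (R : realType) (n : nat) (A M C : 'M[R]_n).
Local Notation B := M^T.
Hypothesis comAB : B *m A - A *m B = C.
Hypothesis comBC : B *m C - C *m B = - 2 *: B.

Lemma transvectant_series f fw (w : 'cV[R]_n) ww s k :
  transvectant M f fw w ww s k = \sum_(i < s.+1)
    ((-1) ^+ i * 'C(s, i)%:R * ((fw - i)`!%:R / (fw - s)`!%:R)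
       * ((ww - s + i)`!%:R / (ww - s)`!%:R)
     * (iter (s - i) (mulmx (- B)) w) k 0) *: iter i (Dop B) f.
Proof.
apply/funext=> m; rewrite series_sum; apply: eq_bigr => i _.
by rewrite seriesZ mulrAC.
Qed.

(** [Lop A] acts on a product of a series and a constant vector as [X] on the first factor plus
    [- A] on the second. The transvectant is the Clebsch-Gordan highest weight vector for this
    action: its coefficients make the contributions telescope. *)
Lemma transvectant_ker f fw (w : 'cV[R]_n) ww s : wvec A C f fw ->
  A *m w = 0 -> - C *m w = ww%:R *: w -> (s <= fw)%N -> (s <= ww)%N ->
  forall k m, Lop A (transvectant M f fw w ww s) k m = 0.
Proof.
move=> [Xf Zf] Aw Cw sf sw k m; rewrite /Lop transvectant_series.
set u := fun i => iter i (mulmx (- B)) w.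
pose c i : R := (-1) ^+ i * 'C(s, i)%:R * ((fw - i)`!%:R / (fw - s)`!%:R)
  * ((ww - s + i)`!%:R / (ww - s)`!%:R).
(* On column vectors [- A], [- B], [- C] satisfy the relations of [X], [Y], [Z]: the sign undoes the
   reversed order of commutators. So [sl2_raise] applies to [w] too. *)
have uXY (x : 'cV[R]_n) : - A *m (- B *m x) = - B *m (- A *m x) + - C *m x.
  have BA : B *m A = A *m B + C by rewrite -comAB addrC subrK.
  by rewrite !mulmxA !(mulNmx, mulmxN, opprK) BA mulmxDl addrK.
have uZY (x : 'cV[R]_n) : - C *m (- B *m x) = - B *m (- C *m x) - 2 *: (- B *m x).
  have CB : C *m B = B *m C + 2 *: B.
    by rewrite -[C *m B](subKr (B *m C)) comBC scaleNr opprK.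
  by rewrite !mulmxA !(mulNmx, mulmxN, opprK) CB mulmxDl -scalemxAl scalerN opprK.
have Aw' : - A *m w = 0 by rewrite mulNmx Aw oppr0.
(* The two contributions to the product of [Y^i f] and [(- B)^(s-i-1) w], from raising [f] and from
   raising [w], cancel. *)
have cS i : (i < s)%N ->
    c i.+1 * (i.+1%:R * (fw%:R - i%:R)) + c i * ((s - i)%:R * (ww%:R - (s - i.+1)%:R)) = 0.
  move=> si; rewrite /c exprS.
  have -> : 'C(s, i.+1)%:R = (s - i)%:R / i.+1%:R * 'C(s, i)%:R :> R.
    by rewrite mulrAC -natrM -mul_bin_left natrM mulrAC mulfV ?mul1r ?pnatr_eq0.
  have -> : (fw - i = (fw - i.+1).+1)%N by lia.
  rewrite factS natrM addnS factS natrM.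
  have -> : fw%:R - i%:R = (fw - i.+1).+1%:R :> R by rewrite -natrB; [congr _%:R|]; lia.
  have -> : ww%:R - (s - i.+1)%:R = (ww - s + i).+1%:R :> R.
    by rewrite -natrB; [congr _%:R|]; lia.
  by field; rewrite addrC natr1 !pnatr_eq0 -!lt0n !fact_gt0.
(* The term [i = 0] drops out because [X f = 0]; in [Asum] the term [i = s] drops out because
   [A *m w = 0]. Both sums then range over [i < s]. *)
have Dsum : Dop A (\sum_(i < s.+1) (c i * u (s - i)%N k 0) *: iter i (Dop B) f) m =
    \sum_(i < s) c i.+1 * (i.+1%:R * (fw%:R - i%:R)) * (u (s - i.+1)%N k 0 * iter i (Dop B) f m).
  rewrite linear_sum big_ord_recl /= linearZ /= Xf scaler0 add0r series_sum.
  apply: eq_bigr => i _; rewrite linearZ /= -iterS.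
  by rewrite (sl2_raise (Dop_XY comAB) (Dop_ZY comBC) Xf Zf) !seriesZ; ring.
have Asum : \sum_l A k l * transvectant M f fw w ww s l m =
    - \sum_(i < s) c i * ((s - i)%:R * (ww%:R - (s - i.+1)%:R))
        * (u (s - i.+1)%N k 0 * iter i (Dop B) f m).
  transitivity (\sum_(i < s.+1) c i * (A *m u (s - i)%N) k 0 * iter i (Dop B) f m).
    transitivity (\sum_l \sum_(i < s.+1) c i * (A k l * u (s - i)%N l 0) * iter i (Dop B) f m).
      apply: eq_bigr => l _; rewrite transvectant_series series_sum mulr_sumr.
      by apply: eq_bigr => i _; rewrite seriesZ -/(u _) -/(c i); ring.
    rewrite exchange_big; apply: eq_bigr => i _ /=.
    by rewrite mxE mulr_sumr mulr_suml.
  rewrite big_ord_recr /= subnn /= Aw mxE mulr0 mul0r addr0 -sumrN; apply: eq_bigr => i _.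
  have si : (s - i = (s - i.+1).+1)%N by have := ltn_ord i; lia.
  have := sl2_raise (X := mulmx (- A)) (Y := mulmx (- B)) (Z := mulmx (- C))
    uXY uZY Aw' Cw (s - i.+1) => /matrixP /(_ k 0).
  rewrite -si -/(u _) -/(u (s - i.+1)%N) [GRing.Linear.sort _ _]/= mulNmx mxE [in RHS]mxE => /eqP.
  by rewrite eqr_oppLR => /eqP ->; ring.
rewrite -/(c _) Dsum Asum opprK -big_split big1 //= => i _.
by rewrite -mulrDl cS // mul0r.
Qed.

End Transvectant.

(** * Index arithmetic of the Jordan blocks *)

Section Blocks.
Variable ns : seq nat.
Local Notation pre j := (sumn (take j ns)).
Local Notation blk := (blk ns).
Local Notation off := (off ns).
Local Notation bsz := (bsz ns).

Lemma pre_succ j : (j < size ns)%N -> pre j.+1 = (pre j + nth 0 ns j)%N.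
Proof. by move=> jq; rewrite (take_nth 0%N) // sumn_rcons. Qed.

Lemma leq_pre i j : (i <= j)%N -> (pre i <= pre j)%N.
Proof.
move=> ij; rewrite -(subnKC ij) takeD sumn_cat; exact: leq_addr.
Qed.

Lemma leq_pre_sumn j : (pre j <= sumn ns)%N.
Proof. by rewrite -{2}(cat_take_drop j ns) sumn_cat leq_addr. Qed.

(** [blk] counts the blocks that end at or before position [i]: the first [j] all do, and no later
    one does. *)
Lemma blk_unique i j : (j < size ns)%N -> (pre j <= i < pre j.+1)%N -> blk i = j.
Proof.
move=> jq /andP[ji ij]; rewrite /Defs.blk -(subnKC (ltnW jq)) iotaD count_cat add0n.
rewrite (_ : count _ (iota 0 j) = j) => [|]; last first.
  rewrite -[RHS](size_iota 0); apply/eqP; rewrite -all_count; apply/allP => b.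
  by rewrite mem_iota => /andP[_ bj]; apply: leq_trans ji; apply: leq_pre.
rewrite (_ : count _ _ = 0%N) ?addn0 //; apply/eqP; rewrite -leqn0 leqNgt -has_count.
apply/hasPn => b; rewrite mem_iota => /andP[jb _]; rewrite -ltnNge.
by apply: leq_trans ij _; apply: leq_pre.
Qed.

Lemma blkP i : (i < sumn ns)%N -> (blk i < size ns)%N /\ (pre (blk i) <= i < pre (blk i).+1)%N.
Proof.
move=> ins; suff [j jq ij] : exists2 j, (j < size ns)%N & (pre j <= i < pre j.+1)%N.
  by rewrite (blk_unique jq).
move: ins; rewrite -{1}(take_size ns); move: (leqnn (size ns)).
elim: {1 3}(size ns) => [|k IH kq]; first by rewrite take0.
have [ik _|ki ik] := ltnP i (pre k); last by exists k; rewrite ?ki.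
exact: IH (ltnW kq) ik.
Qed.

Lemma off_lt i : (i < sumn ns)%N -> (off i < bsz i)%N.
Proof.
by move=> /blkP[bq]; rewrite pre_succ // /Defs.off /Defs.bsz; lia.
Qed.

Lemma off_succ i : (i < sumn ns)%N -> blk i = blk i.+1 -> off i.+1 = (off i).+1.
Proof. by move=> /blkP[_ /andP[bi _]] e; rewrite /Defs.off -e subSn. Qed.

Lemma blk_succ i : (i < sumn ns)%N -> ((off i).+1 < bsz i)%N ->
  (i.+1 < sumn ns)%N /\ blk i.+1 = blk i.
Proof.
move=> /blkP[bq]; rewrite /Defs.off /Defs.bsz => bi oi.
have e : (pre (blk i) <= i.+1 < pre (blk i).+1)%N.
  by move: bi; rewrite pre_succ //; lia.
split; last exact: blk_unique.
by case/andP: e => _ /leq_trans; apply; apply: leq_pre_sumn.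
Qed.

Lemma blk_pred i : (i < sumn ns)%N -> (0 < off i)%N -> blk i.-1 = blk i.
Proof.
move=> /blkP[bq]; rewrite /Defs.off => bi oi.
by apply: blk_unique => //; lia.
Qed.

Lemma bottom_row j : (j < size ns)%N -> (0 < nth 0 ns j)%N ->
  let r := (pre j.+1).-1 in [/\ (r < sumn ns)%N, blk r = j & (off r).+1 = nth 0%N ns j].
Proof.
move=> jq nj /=; have e := pre_succ jq.
have br : blk (pre j.+1).-1 = j by apply: blk_unique => //; lia.
split=> //; last by rewrite /Defs.off br; lia.
by have := leq_pre_sumn j.+1; lia.
Qed.

End Blocks.

(** * The triad of matrices and the components of a field in the kernel *)

Section Triad.
Variables (R : realType) (ns : seq nat).
Local Notation n := (sumn ns).
Local Notation pre j := (sumn (take j ns)).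
Local Notation blk := (blk ns).
Local Notation off := (off ns).
Local Notation bsz := (bsz ns).
Local Notation N := (Nmat R ns).
Local Notation M := (Mmat R ns).
Local Notation H := (Hmat R ns).

(** Row [i] of [N] has its only one in column [i + 1], except in the bottom row of a block, where
    the row is zero and so is the factor [bsz i - (off i).+1]. *)
Lemma NmatM i j : (N *m M) i j =
  ((i == j) * ((off i).+1 * (bsz i - (off i).+1)))%:R.
Proof.
rewrite mxE; have [oi|oi] := ltnP (off i).+1 (bsz i); last first.
  have -> : (bsz i - (off i).+1 = 0)%N by apply/eqP.
  rewrite muln0 muln0 big1 // => l _; rewrite !mxE.
  case: andP => [[/eqP bl /eqP li]|]; last by rewrite mul0r.
  have := off_lt (ltn_ord l); rewrite li off_succ // -?li //.
  by rewrite ltnNge (_ : bsz l = bsz i) ?oi // /Defs.bsz -bl.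
have [iS bS] := blk_succ (ltn_ord i) oi.
rewrite (bigD1 (Ordinal iS)) //= !mxE /= bS !eqxx mul1r big1 => [|l li]; last first.
  rewrite !mxE; case: andP => [[_ /eqP l']|]; last by rewrite mul0r.
  by case/eqP: li; apply: val_inj.
rewrite addr0 eqSS; have [<-|ij] := eqVneq i j; first by rewrite !eqxx mul1n.
by rewrite (_ : (val i == val j) = false) ?andbF //; apply/negbTE.
Qed.

Lemma MmatN i j : (M *m N) i j = ((i == j) * (off i * (bsz i - off i)))%:R.
Proof.
rewrite mxE; have [o0|oi] := posnP (off i).
  rewrite o0 muln0 big1 // => l _; rewrite !mxE.
  case: andP => [[/eqP bl /eqP il]|]; last by rewrite mul0r.
  by move: o0; rewrite il off_succ // -?il.
have bi := blk_pred (ltn_ord i) oi.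
have i0 : (0 < i)%N by move: oi; rewrite /Defs.off; lia.
have iP : (i.-1 < n)%N by have := ltn_ord i; lia.
have oP : off i = (off i.-1).+1 by rewrite -{1}(prednK i0) off_succ // prednK.
rewrite (bigD1 (Ordinal iP)) //= !mxE /= bi prednK // !eqxx big1 => [|l li]; last first.
  rewrite !mxE; case: andP => [[_ /eqP l']|]; last by rewrite mul0r.
  by case/eqP: li; apply: val_inj; rewrite /= l'.
rewrite addr0 -oP {1}/Defs.bsz bi; have [<-|ij] := eqVneq i j; first by rewrite !eqxx mulr1 mul1n.
by rewrite (_ : (val j == val i) = false) ?andbF ?mulr0 //; apply/negbTE; rewrite eq_sym.
Qed.

(** At offset [o] in a block of size [k] the diagonal entry is [(o + 1) (k - o - 1) - o (k - o) = k
    - 1 - 2 o]. *)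
Lemma triad_comNM : M^T *m N^T - N^T *m M^T = H.
Proof.
rewrite -!trmx_mul; apply/matrixP => i j.
have -> : ((N *m M)^T - (M *m N)^T) i j = (N *m M) j i - (M *m N) j i by rewrite !mxE.
rewrite NmatM MmatN [RHS]mxE eq_sym; have [<-|_] := eqVneq i j; last by rewrite !mul0n subr0.
rewrite !mul1n; have := off_lt (ltn_ord i) => ob.
have [e ->] : exists e, bsz i = (off i + e).+1 by exists (bsz i - (off i).+1)%N; lia.
by rewrite subSS subSn ?leq_addr // addKn /= !natrM natrD; ring.
Qed.

Lemma Hmat_diag i j : H i j = (i == j)%:R * H i i.
Proof. by rewrite !mxE eqxx; case: eqP => _; rewrite ?mul1r ?mul0r. Qed.

Lemma Hmat_mul p (u : 'M[R]_(n, p)) i j : (H *m u) i j = H i i * u i j.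
Proof.
rewrite mxE (bigD1 i) //= big1 ?addr0 // => l /negbTE li.
by rewrite Hmat_diag eq_sym li mul0r mul0r.
Qed.

Lemma mul_Hmat p (u : 'M[R]_(p, n)) i j : (u *m H) i j = u i j * H j j.
Proof.
rewrite mxE (bigD1 j) //= big1 ?addr0 // => l /negbTE li.
by rewrite Hmat_diag li mul0r mulr0.
Qed.

Lemma triad_comHM : M^T *m H - H *m M^T = - 2 *: M^T.
Proof.
apply/matrixP => i j.
have -> : (M^T *m H - H *m M^T) i j = (M^T *m H) i j - (H *m M^T) i j by rewrite !mxE.
rewrite mul_Hmat Hmat_mul [RHS]mxE; have -> : M^T i j = M j i by rewrite mxE.
rewrite !mxE !eqxx; case: andP => [[/eqP bl /eqP ji]|]; last by rewrite !(mulr0, mul0r) subr0.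
have -> : off j = (off i).+1 by rewrite ji off_succ // -ji.
rewrite {2}/Defs.bsz bl -/(bsz i) -natr1; ring.
Qed.

(* On a block of size [k] the adjointness of [X] and [Y] requires
   [rho_o / rho_(o+1) = (o + 1) (k - 1 - o)], the entry of [M] below position [o]. *)
Definition trho (i : 'I_n) : R := ((bsz i).-1 - off i)`!%:R / (off i)`!%:R.

Lemma trho_gt0 i : 0 < trho i.
Proof. by rewrite divr_gt0 // ltr0n fact_gt0. Qed.

Lemma trho_adj i j : N^T i j * trho j = M^T j i * trho i.
Proof.
rewrite !mxE eq_sym; case: andP => [[/eqP bl /eqP ij]|]; last by rewrite !mul0r.
have oi : off i = (off j).+1 by rewrite ij off_succ // -ij.
have bE : bsz j = bsz i by rewrite /Defs.bsz bl.
have := off_lt (ltn_ord i); rewrite mul1r /trho bE oi => ob.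
have -> : ((bsz i).-1 - off j = (bsz i - (off j).+1))%N by lia.
have -> : ((bsz i).-1 - (off j).+1 = (bsz i - (off j).+1).-1)%N by lia.
have : (0 < bsz i - (off j).+1)%N by lia.
case: (bsz i - _)%N => // b _; rewrite !factS !natrM /=; field.
by rewrite [1 + _]addrC natr1 !pnatr_eq0 -lt0n fact_gt0.
Qed.

Lemma Hmat_sym i j : H i j * trho j = H j i * trho i.
Proof.
by rewrite Hmat_diag (Hmat_diag j) eq_sym; case: eqP => [->|]; rewrite ?mul0r.
Qed.

Section Kernel.
Variable v : vfield R n.
Hypothesis Lv : forall k m, Lop N^T v k m = 0.

Lemma ker_Lop_top (l : 'I_n) : off l = 0%N -> Dop N^T (v l) = 0.
Proof.
move=> o0; apply/funext=> m; have /eqP := Lv l m; rewrite subr_eq0 => /eqP ->.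
rewrite big1 // => k _; rewrite !mxE; case: andP => [[/eqP bk /eqP lk]|]; last by rewrite mul0r.
by move: o0; rewrite lk off_succ // -lk.
Qed.

Lemma ker_Lop_succ (l k : 'I_n) : blk l = blk k -> k = l.+1 :> nat -> Dop N^T (v k) = v l.
Proof.
move=> bl kl; apply/funext=> m; have /eqP := Lv k m; rewrite subr_eq0 => /eqP ->.
rewrite (bigD1 l) //= !mxE bl kl !eqxx mul1r big1 ?addr0 // => i il.
rewrite !mxE; case: andP => [[_ /eqP ki]|]; last by rewrite mul0r.
by case/eqP: il; apply: val_inj; case: ki; rewrite kl => -[].
Qed.

Lemma ker_Lop_iter e (l r : 'I_n) : (off l + e).+1 = bsz l ->
  r = (pre (blk l).+1).-1 :> nat -> v l = iter e (Dop N^T) (v r).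
Proof.
elim: e l => [|e IH] l ol rE.
  suff -> : r = l by []; apply: val_inj; rewrite /= rE.
  have [bq] := blkP (ltn_ord l); move: ol; rewrite /Defs.off /Defs.bsz pre_succ //; lia.
have [lS bS] := blk_succ (ltn_ord l) (ltac:(lia) : ((off l).+1 < bsz l)%N).
rewrite iterS -(IH (Ordinal lS)) /= ?bS //; first by rewrite (@ker_Lop_succ l (Ordinal lS)).
by rewrite off_succ // {1}/Defs.bsz bS -/(bsz l); lia.
Qed.

(** The top component of the block is [X^(n_j - 1)] of the bottom one, and one more [X] kills it. *)
Lemma ker_Lop_bottom j (r : 'I_n) : (j < size ns)%N -> (0 < nth 0 ns j)%N ->
  r = (pre j.+1).-1 :> nat -> iter (nth 0%N ns j) (Dop N^T) (v r) = 0.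
Proof.
move=> jq nj rE; have e := pre_succ jq.
have tn : (pre j < n)%N by have := leq_pre_sumn ns j.+1; lia.
have bt : blk (pre j) = j by apply: blk_unique => //; lia.
have ot : off (pre j) = 0%N by rewrite /Defs.off bt subnn.
rewrite -(prednK nj) iterS -(@ker_Lop_iter _ (Ordinal tn)) ?ker_Lop_top //=; last by rewrite bt.
by rewrite /Defs.bsz bt ot add0n prednK.
Qed.

End Kernel.

(** The bottom row has offset [n_j - 1], where [H] has entry [-(n_j - 1)], and the block has no
    lower row for [N^T] to map into. *)
Lemma bvec_hw j : (j < size ns)%N -> (0 < nth 0 ns j)%N ->
  N^T *m bvec R ns j = 0 /\ - H *m bvec R ns j = (nth 0%N ns j).-1%:R *: bvec R ns j.
Proof.
move=> jq nj; have [rn br or] := bottom_row jq nj.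
split; apply/matrixP => i i0.
  rewrite !mxE big1 // => l _; rewrite !mxE; case: (eqVneq (val l)) => [lr|]; last by rewrite mulr0.
  case: andP => [[/eqP bl /eqP il]|]; last by rewrite mul0r.
  have := off_lt (ltn_ord i); rewrite il off_succ // -?il // -/(val l) lr or.
  by rewrite /Defs.bsz -bl -/(val l) lr br ltnn.
have -> : (- H *m bvec R ns j) i i0 = - (H *m bvec R ns j) i i0 by rewrite mulNmx mxE.
rewrite Hmat_mul !mxE eqxx; case: (eqVneq (val i)) => [ir|]; last by rewrite !mulr0 oppr0.
have oi : (off i).+1 = bsz i by rewrite /Defs.bsz -/(val i) ir br or.
rewrite -[nth 0%N ns j]or -ir -oi /= !mulr1; ring.
Qed.

End Triad.

(** The coefficient of the term [i = s] of a transvectant, where the binomial and the quotient from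
    the weight of the series equal one. *)
Definition bcoef (R : realType) (ww s : nat) : R := (-1) ^+ s * (ww`!%:R / (ww - s)`!%:R).

Lemma bcoef_neq0 (R : realType) ww s : bcoef R ww s != 0.
Proof.
by rewrite !mulf_neq0 ?invr_eq0 ?signr_eq0 ?pnatr_eq0 -?lt0n ?fact_gt0.
Qed.

(* The entries of [M^T u] in the bottom rows vanish, so only the term [i = s] of the
   transvectant contributes there. *)
Lemma transvectant_bottom (R : realType) (ns : seq nat) f fw j j' s (r : 'I_(sumn ns)) :
  all (fun k => 0 < k)%N ns -> (j < size ns)%N -> (j' < size ns)%N ->
  (s <= (nth 0 ns j).-1)%N -> r = (sumn (take j'.+1 ns)).-1 :> nat ->
  transvectant (Mmat R ns) f fw (bvec R ns j) (nth 0%N ns j).-1 s r =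
  ((j' == j)%:R * bcoef R (nth 0%N ns j).-1 s) *: iter s (Dop (Mmat R ns)^T) f.
Proof.
move=> /all_nthP ns0 jq j'q sw rE.
have [rn br or] := bottom_row jq (ns0 0%N _ jq).
have [rn' br' or'] := bottom_row j'q (ns0 0%N _ j'q).
rewrite transvectant_series big_ord_recr big1 /= ?add0r => [|i _].
  rewrite subnn /= mxE rE -/(_ == _); congr (_ *: _).
  have -> : ((sumn (take j'.+1 ns)).-1 == (sumn (take j.+1 ns)).-1) = (j' == j).
    by apply/eqP/eqP => [e|->//]; rewrite -br' e br.
  rewrite binn subnK // divff ?pnatr_eq0 -?lt0n ?fact_gt0 // !mulr1 /bcoef.
  by rewrite mulrC.
have -> : (s - i = (s - i.+1).+1)%N by have := ltn_ord i; lia.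
rewrite iterS /= mulNmx mxE mxE big1 ?oppr0 ?mulr0 ?scale0r // => l _.
rewrite !mxE; case: andP => [[/eqP bl /eqP lr]|]; last by rewrite mul0r.
have := off_lt (ltn_ord l); rewrite lr off_succ // -?lr //.
by rewrite /bsz bl rE br' or' ltnn.
Qed.

(** * Assembly of the basis of the kernel from the bottom rows *)

Theorem theorem17p5 (R : realType) (ns : seq nat) (p : nat)
  (alpha : 'I_p -> series R (sumn ns)) (ahat : 'I_p -> nat)
  (A : {ffun 'I_p -> nat} -> Prop) :
  all (fun k => 0 < k)%N ns ->
  hilbert_basis (Nmat R ns) (Hmat R ns) alpha ahat ->
  std_pref_set (Nmat R ns) alpha A ->
  let adm := fun t : {ffun 'I_p -> nat} * nat * nat =>
    [/\ A t.1.1, (t.1.2 < size ns)%N, (t.2 <= wdot ahat t.1.1)%N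
      & (t.2 <= (nth 0%N ns t.1.2).-1)%N] in
  let T := fun t : {ffun 'I_p -> nat} * nat * nat =>
    transvectant (Mmat R ns) (amono alpha t.1.1) (wdot ahat t.1.1)
      (bvec R ns t.1.2) (nth 0%N ns t.1.2).-1 t.2 in
  [/\ (forall t, adm t -> forall k m, Lop (Nmat R ns)^T (T t) k m = 0),
      lin_indep adm (fun t (x : 'I_(sumn ns) * mon (sumn ns)) => T t x.1 x.2) &
      (forall v : vfield R (sumn ns), (forall k m, Lop (Nmat R ns)^T v k m = 0) ->
         fcomb adm (fun t (x : 'I_(sumn ns) * mon (sumn ns)) => T t x.1 x.2)
               (fun x => v x.1 x.2))].
Proof.
move=> ns_gt0 [basis _] [_ free span _] adm T.
have nsP j : (j < size ns)%N -> (0 < nth 0 ns j)%N by move/all_nthP: ns_gt0; apply.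
have awt k : wvec (Nmat R ns)^T (Hmat R ns) (amono alpha k) (wdot ahat k).
  apply: wvec_amono => i; have [[Xa Za] _] := basis i.
  by split; apply/funext.
have ahom k : homogeneous (amono alpha k) by apply: homogeneous_amono => i; case: (basis i).
have aspan f : Dop (Nmat R ns)^T f = 0 -> fcomb A (amono alpha) f.
  by move=> f0; apply: span => m; rewrite f0.
have Tker t : adm t -> forall k m, Lop (Nmat R ns)^T (T t) k m = 0.
  case=> _ jq sw sn; have [Nb Hb] := bvec_hw R jq (nsP _ jq).
  exact: (transvectant_ker (triad_comNM R ns) (triad_comHM R ns) (awt _) Nb Hb sw sn).
have Tbot t j (r : 'I_(sumn ns)) : adm t -> (j < size ns)%N ->
    r = (sumn (take j.+1 ns)).-1 :> nat ->
    T t r = ((j == t.1.2)%:R * bcoef R (nth 0%N ns t.1.2).-1 t.2)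
      *: iter t.2 (Dop (Mmat R ns)^T) (amono alpha t.1.1).
  by case=> _ tq _ tn jq rE; apply: transvectant_bottom.
have Yfree := iterY_free (triad_comNM R ns) (triad_comHM R ns) (fun k _ => awt k) free.
have Yspan := ker_iterX_span (@trho_gt0 R ns) (triad_comNM R ns) (triad_comHM R ns)
  (@trho_adj R ns) (@Hmat_sym R ns) (fun k _ => ahom k) (fun k _ => awt k) free aspan.
split=> // [s c us sadm s0 [[k0 j] s1] ts|v Lv].
  have [/= _ jq _ _] := sadm _ ts.
  (* At the bottom row of block [j] the relation keeps only the terms built on [b_j] and becomes one
     between the [Y^s alpha^k]. *)
  have [rn _ _] := bottom_row jq (nsP _ jq); pose r := Ordinal rn.
  suff /eqP : c (k0, j, s1) * bcoef R (nth 0%N ns j).-1 s1 = 0.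
    by rewrite mulf_eq0 (negbTE (bcoef_neq0 _ _ _)) orbF => /eqP.
  apply: (Yfree [seq (t.1.1, t.2) | t <- s & t.1.2 == j]
    (fun u => c (u.1, j, u.2) * bcoef R (nth 0%N ns j).-1 u.2) _ _ _ (k0, s1)).
  - rewrite map_inj_in_uniq ?filter_uniq // => -[[k2 j2] s2] [[k3 j3] s3].
    by rewrite !mem_filter /= => /andP[/eqP -> _] /andP[/eqP -> _] [-> ->].
  - by move=> u /mapP[t]; rewrite mem_filter => /andP[_ /sadm[? _ ? _]] ->.
  - move=> m; rewrite big_map big_filter -[RHS](s0 (r, m)) /=.
    rewrite [RHS](bigID (fun t => t.1.2 == j)) /= [X in _ + X]big_seq_cond.
    rewrite [X in _ + X]big1 ?addr0 => [|t /andP[/sadm ta tj]].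
      rewrite big_seq_cond [RHS]big_seq_cond; apply: eq_bigr => -[[k2 j2] s2] /= /andP[tin /eqP tj].
      move: tin; rewrite tj => /sadm ta.
      by rewrite (Tbot _ j) // eqxx mul1r seriesZ mulrA.
    by rewrite (Tbot _ j) // eq_sym (negbTE tj) mul0r scale0r mulr0.
  by apply/mapP; exists (k0, j, s1); rewrite // mem_filter eqxx.
(* Choice needs coefficients for every natural number [j]; outside the range of blocks the zero
   family serves as a default. *)
have /choice[c Hc] : forall j, exists c, forall r : 'I_(sumn ns), (j < size ns)%N ->
    r = (sumn (take j.+1 ns)).-1 :> nat ->
    dcomb (fun t => [/\ A t.1, (t.2 <= wdot ahat t.1)%N & (t.2 < nth 0 ns j)%N])
      (fun t => iter t.2 (Dop (Mmat R ns)^T) (amono alpha t.1)) c (v r).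
  move=> j; have [jq|] := ltnP j (size ns); last by exists (fun=> 0).
  have [rn _ _] := bottom_row jq (nsP _ jq).
  have [c Hc] := Yspan _ _ (ker_Lop_bottom Lv (r := Ordinal rn) jq (nsP _ jq) erefl).
  by exists c => r _ rE; rewrite (_ : r = Ordinal rn) //; apply: val_inj.
exists (fun t => c t.1.2 (t.1.1, t.2) / bcoef R (nth 0%N ns t.1.2).-1 t.2) => -[l m] /=.
set j := blk ns l; have [jq _] := blkP (ltn_ord l); rewrite -/j in jq.
have [rn _ _] := bottom_row jq (nsP _ jq); pose r := Ordinal rn.
(* [e] is the number of rows from [l] down to the bottom of its block, so component [l] of a field
   in the kernel is [X^e] of its bottom component. *)
have [e le] : exists e, (off ns l + e).+1 = bsz ns l.
  by exists (bsz ns l - (off ns l).+1)%N; have := off_lt (ltn_ord l); lia.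
have upE w : (forall k m, Lop (Nmat R ns)^T w k m = 0) ->
    w l = iter e (Dop (Nmat R ns)^T) (w r) by move=> Lw; apply: ker_Lop_iter.
have [S [uS PS cS vS]] := Hc j r jq erefl (mdeg m).
have admS k s : (k, s) \in S -> adm (k, j, s).
  by move=> /PS[/= Ak sk sj]; split=> //=; rewrite -ltnS prednK ?nsP.
have Tl k s : adm (k, j, s) -> T (k, j, s) l = bcoef R (nth 0%N ns j).-1 s *:
    iter e (Dop (Nmat R ns)^T) (iter s (Dop (Mmat R ns)^T) (amono alpha k)).
  move=> ta; rewrite (upE _ (Tker _ ta)) (Tbot _ j) // eqxx mul1r; exact: iter_DopZ.
exists [seq (u.1, j, u.2) | u <- S]; split.
- by rewrite map_inj_uniq // => -[? ?] [? ?] [-> ->].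
- by move=> t /mapP[[k s] kS] ->; apply: admS.
(* A transvectant built on another block has zero bottom component in block [j], hence zero
   component [l]. *)
- move=> [[k j'] s] ta /=; have [jE|jj'] := eqVneq j j'; last first.
    rewrite (upE _ (Tker _ ta)) (Tbot _ j) //= (negbTE jj') mul0r scale0r iter_Dop0.
    by rewrite mulr0 eqxx.
  rewrite -jE in ta *; rewrite Tl // seriesZ mulrA divfK ?bcoef_neq0 // => ck.
  apply/mapP; exists (k, s) => //; apply: contraNT ck => kS.
  rewrite -seriesZ -iter_DopZ (@iter_Dop_local _ _ _ (mdeg m) _ 0) ?iter_Dop0 // => m' md'.
  rewrite seriesZ; apply: contraNeq kS => ck.
  apply: (cS _ m') => //; have [/= ? _ ? sn] := ta; split=> //=.
  by rewrite -(prednK (nsP _ jq)) ltnS.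
rewrite (upE _ Lv) big_map /=.
(* [X^e] preserves degree, so [v r] may be replaced by the finite sum that agrees with it in the
   degree of [m]. *)
rewrite (@iter_Dop_local _ _ _ (mdeg m) _
  (\sum_(u <- S) c j u *: iter u.2 (Dop (Mmat R ns)^T) (amono alpha u.1))) => [|m' md'|//].
  rewrite iter_Dop_sum series_sum big_seq [RHS]big_seq; apply: eq_bigr => -[k s] /= kS.
  by rewrite (Tl _ _ (admS _ _ kS)) !seriesZ mulrA divfK ?bcoef_neq0.
by rewrite vS // series_sum.
Qed.
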